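(* Let $p$ be a prime, let $P$ be a nontrivial finite $p$-group and let $G=\operatorname{Cay}(P,S)$ be a simple undirected Cayley graph of regularity $k=|S|$. Suppose $p\nmid k$. Then for every abelian group $\Gamma$ of order $|P|$, the graph $G$ admits no affinely generating $\Gamma$-magic map and no $\Gamma$-distance magic labeling. It admits a generating $\Gamma$-magic map if and only if $\Gamma$ is cyclic.
   Context: For a finite (not necessarily abelian) group $P$ and an inverse-closed set $S\subseteq P\setminus\{1\}$, $\operatorname{Cay}(P,S)$ is the graph with vertex set $P$ in which $x$ is adjacent to $y$ if and only if $x^{-1}y\in S$. For a finite abelian group $\Gamma$ (written additively), a map $f\colon V(G)\to\Gamma$ is a $\Gamma$-magic map if there is $\gamma\in\Gamma$ with $\sum_{u\in N_G(v)}f(u)=\gamma$ for every $v\in V(G)$, where $N_G(v)$ is the open neighborhood. It is generating if $\langle f(v)\mid v\in V(G)\rangle=\Gamma$, and affinely generating if $\langle f(v)-f(w)\mid v,w\in V(G)\rangle=\Gamma$. A $\Gamma$-distance magic labeling is a bijective $\Gamma$-magic map. *)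

(* Defs.v *)
From mathcomp Require Import all_boot all_fingroup all_algebra.

Set Implicit Arguments.
Unset Strict Implicit.
Unset Printing Implicit Defensive.

(* Graphs on a finite vertex type are given by their adjacency relation. *)

Definition simple_undirected (V : finType) (adj : rel V) : Prop :=
  symmetric adj /\ irreflexive adj.

Definition open_nbhd (V : finType) (adj : rel V) (v : V) : {set V} :=
  [set u | adj v u].

Definition regular_graph (V : finType) (adj : rel V) (k : nat) : Prop :=
  forall v : V, #|open_nbhd adj v| = k.

Definition inverse_closed (gT : finGroupType) (S : {set gT}) : Prop :=
  forall s : gT, s \in S -> (s^-1)%g \in S.

(* The ambient group is the whole type gT. *)
Definition Cay (gT : finGroupType) (S : {set gT}) : rel gT :=
  fun x y => (x^-1 * y)%g \in S.

Lemma Cay_simple_undirected (gT : finGroupType) (S : {set gT}) :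
  (1%g \notin S) -> inverse_closed S -> simple_undirected (Cay S).
Proof.
move=> S1 SV; split=> [x y|x]; last by rewrite /Cay mulVg (negbTE S1).
by apply/idP/idP => /SV; rewrite /Cay invMg invgK.
Qed.

Lemma Cay_regular (gT : finGroupType) (S : {set gT}) :
  regular_graph (Cay S) #|S|.
Proof.
move=> x; rewrite -(card_lcoset S x); apply: eq_card => y.
by rewrite inE mem_lcoset.
Qed.

Section MagicMaps.

Variables (V : finType) (adj : rel V) (Gamma : finZmodType).
Implicit Type f : V -> Gamma.

Definition magic_map f : Prop :=
  exists gamma : Gamma,
    forall v : V, (\sum_(u in open_nbhd adj v) f u)%R = gamma.

(* <<_>> is the generated subgroup for the additive group law of Gamma, through
   the canonical finGroupType structure of a finZmodType. *)
Definition generating f : Prop :=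
  <<[set f v | v : V]>>%g = [set: Gamma].

Definition affinely_generating f : Prop :=
  <<[set (f v - f w)%R | v : V, w : V]>>%g = [set: Gamma].

Definition distance_magic_labeling f : Prop :=
  magic_map f /\ bijective f.

End MagicMaps.

(* Main.v *)
Require Import Defs.
From HB Require Import structures.
From mathcomp Require Import all_boot all_fingroup all_algebra all_solvable.

(** A magic map is constant: its differences with its left translates lie in the
kernel of the adjacency operator on the functions from P to Gamma, and that
kernel K is trivial. Indeed K is a p-group on which P acts by left translation,
so if K were nontrivial then P would fix a nonzero element of K. This is a
nonzero constant c with k c = 0, impossible when p does not divide k. *)

Import GRing.Theory.

(* Makes {ffun aT -> Gamma} a finZmodType, hence a finGroupType. *)
HB.saturate finfun_of.

Section CayleyMagic.

Local Open Scope ring_scope.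
Variables (gT : finGroupType) (S : {set gT}) (Gamma : finZmodType).
Implicit Types (f : gT -> Gamma) (h : {ffun gT -> Gamma}) (x v : gT).

Lemma sum_Cay_nbhd f v :
  \sum_(u in open_nbhd (Cay S) v) f u = \sum_(s in S) f (v * s)%g.
Proof.
rewrite (reindex_inj (mulgI v)) /=.
by apply: eq_bigl => s; rewrite inE /Cay mulKg.
Qed.

(** Precomposition with left multiplication is a right action, as [act_morph] requires. *)
Definition translate h x : {ffun gT -> Gamma} := [ffun v => h (x * v)%g].

Lemma translate1 : translate^~ 1%g =1 id.
Proof. by move=> h; apply/ffunP => v; rewrite ffunE mul1g. Qed.

Lemma translateM h : act_morph translate h.
Proof. by move=> x y; apply/ffunP => v; rewrite !ffunE mulgA. Qed.

Definition translate_action := TotalAction translate1 translateM.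

Definition Cay_kernel : {set {ffun gT -> Gamma}} :=
  [set h : {ffun gT -> Gamma} | [forall v, \sum_(s in S) h (v * s)%g == 0]].

Lemma Cay_kernelP h :
  reflect (forall v, \sum_(s in S) h (v * s)%g = 0) (h \in Cay_kernel).
Proof. by rewrite inE; apply: (iffP forallP) => h0 v; apply/eqP/h0. Qed.

Lemma Cay_kernel_group_set : group_set Cay_kernel.
Proof.
apply/group_setP; split=> [|g h /Cay_kernelP g0 /Cay_kernelP h0].
  by apply/Cay_kernelP => v; rewrite big1 // => s _; rewrite ffunE.
apply/Cay_kernelP => v.
under eq_bigr do rewrite ffunE.
by rewrite big_split /= g0 h0 addr0.
Qed.

Canonical Cay_kernel_group := Group Cay_kernel_group_set.

(** Left translations commute with the right multiplications by elements of [S]: the sum for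
    [translate h x] at [v] is the sum for [h] at [x * v]. *)
Lemma acts_Cay_kernel : [acts [set: gT], on Cay_kernel | translate_action].
Proof.
apply/subsetP => x _; rewrite !inE /=; apply/subsetP => h /Cay_kernelP h0.
rewrite inE; apply/Cay_kernelP => v /=.
by under eq_bigr do rewrite ffunE mulgA.
Qed.

Variable p : nat.
Hypothesis pG : (p.-group [set: gT])%g.
Hypothesis pGamma : (p.-group [set: Gamma])%g.
Hypothesis pS : ~~ (p %| #|S|)%N.

Lemma Cay_kernel_trivial h : h \in Cay_kernel -> h = 0.
Proof.
have pK : (p.-group Cay_kernel)%g.
  apply: pgroupS (subsetT _) _.
  by rewrite /pgroup cardsT card_ffun pnatX -cardsT [pnat _ _]pGamma.
have [K1|ntK] := eqVneq Cay_kernel 1%g; first by rewrite K1 => /set1P.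
have [p_pr p_dvd_K _] := pgroup_pdiv pK ntK.
(* Orbit counting: the order of the kernel and the number of its fixed points agree modulo [p], so
   [p] divides the latter. *)
have := pgroup_fix_mod pG acts_Cay_kernel.
rewrite (eqnP p_dvd_K) => /esym/eqP; rewrite -/(dvdn _ _) => p_dvd_Fix.
set Fix := 'Fix_(_ | _)(_)%g in p_dvd_Fix.
have Fix0 : 0 \in Fix.
  rewrite inE (group1 Cay_kernel_group); apply/afixP => x _ /=.
  by apply/ffunP => v; rewrite !ffunE.
(* A positive multiple of [p] exceeds 1, so it suffices that 0 is the only fixed point. *)
have /card_gt1P[g1 [g2 [Fg1 Fg2 ne_g12]]] : (1 < #|Fix|)%N.
  apply: leq_trans (prime_gt1 p_pr) (dvdn_leq _ p_dvd_Fix).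
  by apply/card_gt0P; exists 0.
suff Fix_0 g : g \in Fix -> g = 0.
  by rewrite (Fix_0 _ Fg1) (Fix_0 _ Fg2) eqxx in ne_g12.
case/setIP => /Cay_kernelP/(_ 1%g) g_ker /afixP g_fix.
(* Invariance under translation by [v], read at the identity. *)
have g_const v : g v = g 1%g.
  by have /ffunP/(_ 1%g) := g_fix v (in_setT v); rewrite /= ffunE mulg1.
have gS0 : g 1%g *+ #|S| = 0.
  by rewrite -sumr_const -[RHS]g_ker; apply: eq_bigr => s _; rewrite [RHS]g_const.
(* As [#|S|] is prime to the order of [Gamma], multiplication by [#|S|] is injective there; [expgK]
   states this with multiples written as powers. *)
have co : coprime #|[set: Gamma]| #|S|.
  by rewrite coprime_sym; apply: p'nat_coprime pGamma; rewrite p'natE.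
apply/ffunP => v; rewrite g_const ffunE.
by apply: (can_in_inj (expgK co)); rewrite ?in_setT //  [LHS]gS0 expg1n.
Qed.

Lemma Cay_magic_const f : magic_map (Cay S) f -> forall v, f v = f 1%g.
Proof.
case=> gamma f_magic x.
have f_sum v : \sum_(s in S) f (v * s)%g = gamma by rewrite -sum_Cay_nbhd.
(* The sums for the two terms of [h] at [v] are those of [f] at [x * v] and at [v], both equal to
   [gamma]. The value of [h] at the identity is [f x - f 1]. *)
pose h := [ffun v => f (x * v)%g - f v].
suff /Cay_kernel_trivial/ffunP/(_ 1%g) : h \in Cay_kernel.
  by rewrite !ffunE mulg1 => /subr0_eq.
apply/Cay_kernelP => v; under eq_bigr do rewrite ffunE mulgA.
by rewrite sumrB !f_sum subrr.
Qed.

End CayleyMagic.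

Theorem theorem5p4 (p : nat) (gT : finGroupType) (S : {set gT}) (k : nat) :
  prime p ->
  (p.-group [set: gT])%g ->
  [set: gT] != 1%g ->
  (1%g \notin S) ->
  inverse_closed S ->
  #|S| = k ->
  ~~ (p %| k) ->
  forall Gamma : finZmodType, #|Gamma| = #|gT| ->
    [/\ ~ (exists f : gT -> Gamma,
             magic_map (Cay S) f /\ affinely_generating f),
        ~ (exists f : gT -> Gamma, distance_magic_labeling (Cay S) f)
      & (exists f : gT -> Gamma, magic_map (Cay S) f /\ generating f)
        <-> cyclic [set: Gamma]].
Proof.
move=> _ pG ntG _ _ <- pS Gamma cardGamma.
have pGamma : (p.-group [set: Gamma])%g by rewrite /pgroup cardsT cardGamma -cardsT.
have magic_const := @Cay_magic_const gT S Gamma p pG pGamma pS.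
have gT_gt1 : 1 < #|gT| by rewrite -cardsT cardG_gt1.
split.
- case=> f [/magic_const f_const].
  rewrite /affinely_generating => /(congr1 (fun A : {set Gamma} => #|A|)).
  (* All differences of a constant map vanish, so they generate a trivial group, whereas [Gamma] has
     more than one element. *)
  suff -> : [set (f v - f w)%R | v : gT, w : gT] = 1%g.
    by rewrite genGid cards1 cardsT cardGamma => E; rewrite -E in gT_gt1.
  apply/setP => y; rewrite !inE; apply/imset2P/eqP => [[v w _ _ ->]|->].
    by rewrite (f_const v) (f_const w) subrr.
  by exists 1%g 1%g => //; rewrite subrr.
- case=> f [/magic_const f_const /bij_inj f_inj].
  have /trivgPn[x _ /eqP[]] := ntG.
  by apply: f_inj; rewrite f_const.
split=> [[f [/magic_const f_const gen_f]]|/cyclicP[c GammaE]].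
  apply/cyclicP; exists (f 1%g); rewrite -gen_f; congr <<_>>%g.
  apply/setP => y; rewrite inE; apply/imsetP/eqP => [[v _ ->]|->] //.
  by exists 1%g.
(* The constant map at a generator is magic because every neighborhood has [#|S|] elements. *)
exists (fun=> c); split.
  by exists (c *+ #|S|)%R => v; rewrite sum_Cay_nbhd sumr_const.
rewrite /generating GammaE; congr <<_>>%g.
apply/setP => y; rewrite inE; apply/imsetP/eqP => [[v _ ->]|->] //.
by exists 1%g.
Qed.
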